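(* In the setting of the context (a weighted genus two admissible cover over the standard log point, with real-metrised tropicalisation $\Gamma$, associated function $\lambda$, and $\rho_1$ the value of $\lambda$ on the special vertex or vertices), the subcurve $\Gamma_{\ge\rho_1}=\{x\in\Gamma:\lambda(x)\ge\rho_1\}$ is connected.
   Context: *Admissible cover.* Over $\mathbb C$, let $\psi\colon(C,D_R)\to(T,D_B)$ be a hyperelliptic admissible cover: a finite degree two morphism of nodal curves, $C$ connected of arithmetic genus $2$, $T$ of genus $0$, étale on $C^{sm}\setminus D_R$, simply ramified along the six smooth points $D_R$ mapping to six distinct smooth points $D_B$, mapping nodes to nodes with the same ramification order $1$ or $2$ on both branches. It carries a weight $w\colon V(\Gamma)\to\mathbb N$ on the dual graph of $C$, not identically zero, such that with $w_T(v)=\sum_{v'\mapsto v}w(v')$ every component of $T$ with $w_T=0$ has at least three nodes or branch points. *Metric.* $\Gamma=\mathrm{trop}(C)$ and the tree $\Gamma_T=\mathrm{trop}(T)$ are the dual graphs with positive real edge lengths, where the length of an edge of $\Gamma_T$ is the ramification order (expansion factor) times the length of any edge of $\Gamma$ above it; $\mathrm{trop}(\psi)\colon\Gamma\to\Gamma_T$ is the induced harmonic map of degree two. For a subcurve, genus means arithmetic genus: first Betti number plus sum of vertex genera. *Functions.* A piecewise linear (PL) function has integral slopes on (a subdivision of) $\Gamma$ (half-integral slopes allowed on $\Gamma_T$); $\mathrm{div}(\lambda)(v)$ is the sum of outgoing slopes at $v$; $K_\Gamma(v)=2g(v)-2+\mathrm{val}(v)$. Pullback along $\mathrm{trop}(\psi)$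 composes functions and multiplies divisors by local degrees. On $\Gamma_T$ let $D'(v)=\mathrm{val}(v)-2+\tfrac12\deg(D_B|_v)$ (valence counts edges only); it has degree $1$ and pulls back to $K_\Gamma$. For each vertex $v_0$ of $\Gamma_T$ there is a PL function $\overline\lambda_T$, unique up to constants, with $D'+\mathrm{div}(\overline\lambda_T)=v_0$; its pullback to $\Gamma$ is an *admissible function*. Let $\overline\lambda_1,\dots,\overline\lambda_s$ be all of them and let $\lambda_i$ be $\overline\lambda_i$ shifted by a constant so that vertices with $\lambda_i>0$ have weight $0$ while those with $\lambda_i\ge0$ have total weight $\ge1$ (i.e. the maximum of $\lambda_i$ on vertices of positive weight is $0$). Define $\lambda=\max\{0,\lambda_1,\dots,\lambda_s\}$, a PL function on a subdivision of $\Gamma$, pulled back from $\lambda_T$ on $\Gamma_T$. Put $\Delta^\circ=\{\lambda>0\}$ and let $\Delta$ be the minimal subcurve of genus two containing the closure of $\Delta^\circ$, $\Delta_T$ its image in $\Gamma_T$. With $D'$ computed using valences in $\Delta_T$, $D=D'+\mathrm{div}(\lambda_T)$ is an effective divisor of degree $1$ with half-integral coefficients on $\Delta_T$ and $\mathrm{trop}(\psi)^*D=K_\Delta+\mathrm{div}(\lambda)$ on $\Delta$. The point(s) supporting $D$, and their preimages in $\Gamma$, are called special; if $D$ is half the sum of two distinct points then $\lambda$ is $0$ at both, so the value $\rho_1\ge0$ of $\lambda$ on the special vertex(ices) is well defined. *)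

(* Defs.v *)
From HB Require Import structures.
From mathcomp Require Import all_boot all_order all_algebra.
From mathcomp Require Import all_classical all_reals all_analysis.

Set Implicit Arguments.
Unset Strict Implicit.
Unset Printing Implicit Defensive.
Import Order.TTheory GRing.Theory Num.Theory.
Import numFieldNormedType.Exports.

Local Open Scope classical_set_scope.
Local Open Scope ring_scope.

(* The orientation of the edges (src, tgt) is auxiliary: it only serves to
   parametrise edges. Multiple edges are allowed. *)
Record metric_graph (R : realType) := MetricGraph {
  vert : finType;
  edge : finType;
  src : edge -> vert;
  tgt : edge -> vert;
  len : edge -> R;
  len_gt0 : forall e, 0 < len e }.

Definition adj (R : realType) (G : metric_graph R) : rel (vert G) :=
  fun u v => [exists e : edge G, ((src e == u) && (tgt e == v))
                              || ((src e == v) && (tgt e == u))].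

Definition graph_connected (R : realType) (G : metric_graph R) : Prop :=
  forall u v : vert G, fingraph.connect (adj (G := G)) u v.

Section Realisation.
Variables (R : realType) (G : metric_graph R).

(* Points of the geometric realisation: the vertices, and the pairs (e, t) with
   t strictly between 0 and the length of e. *)
Definition is_point (x : vert G + edge G * R) : bool :=
  match x with
  | inl _ => true
  | inr (e, t) => (0 < t) && (t < len e)
  end.

Definition gpoint : Type := {x : vert G + edge G * R | is_point x}.

HB.instance Definition _ := Choice.on gpoint.

Definition vpoint (v : vert G) : gpoint := exist _ (inl v) isT.

(* The parametrisation of e, from src e at 0 to tgt e at len e, extended by
   constants to all of R. *)
Definition chart (e : edge G) (t : R) : gpoint :=
  insubd (vpoint (if t <= 0 then src e else tgt e)) (inr (e, t)).

(* The quotient (final) topology: a set is open iff its preimage in every edge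
   is open. *)
Definition open_point : set_system gpoint :=
  [set U | forall e : edge G, open (chart e @^-1` U)].

Lemma open_pointT : open_point setT.
Proof. by move=> e; rewrite preimage_setT; exact: openT. Qed.

Lemma open_pointI : setI_closed open_point.
Proof. by move=> A B oA oB e; rewrite preimage_setI; exact: openI. Qed.

Lemma open_point_bigU (I : Type) (f : I -> set gpoint) :
  (forall i, open_point (f i)) -> open_point (\bigcup_i f i).
Proof.
move=> of_ e; rewrite preimage_bigcup.
by apply: bigcup_open => i _; exact: of_.
Qed.

HB.instance Definition _ := isOpenTopological.Build gpoint
  open_pointT open_pointI open_point_bigU.

(* A tangent direction is an oriented edge: (e, false) runs from src e to
   tgt e, and (e, true) runs from tgt e to src e. *)
Definition tangent (p : gpoint) : {set edge G * bool} :=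
  match val p with
  | inl v => [set d | (if d.2 then tgt d.1 else src d.1) == v]%SET
  | inr (e, _) => [set d | d.1 == e]%SET
  end.

(* The point at distance h from p in the direction d (for h small). *)
Definition advance (p : gpoint) (d : edge G * bool) (h : R) : gpoint :=
  let t := match val p with
           | inl _ => if d.2 then len d.1 else 0
           | inr (_, t) => t
           end in
  chart d.1 (if d.2 then t - h else t + h).

Definition slope (f : gpoint -> R) (p : gpoint) (d : edge G * bool) : R :=
  lim ((f (advance p d h) - f p) / h @[h --> 0^'+]).

Definition pldiv (f : gpoint -> R) (p : gpoint) : R :=
  \sum_(d in tangent p) slope f p d.

(* On each edge there is a subdivision 0 < s_1 < ... < s_n = len e such that f
   is affine with slope in Sl on each closed segment of it. *)
Definition piecewise_linear (Sl : set R) (f : gpoint -> R) : Prop :=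
  forall e : edge G, exists s : seq R,
    [/\ path <%R 0 s, last 0 s = len e &
        forall i, (i < size s)%N ->
          let a := nth 0 (0 :: s) i in let b := nth 0 s i in
          exists2 c, Sl c &
            forall t, a <= t <= b -> f (chart e t) = f (chart e a) + c * (t - a)].

Definition dir_in (A : set gpoint) (p : gpoint) (d : edge G * bool) : Prop :=
  \forall h \near 0^'+, A (advance p d h).

Definition open_cell (s : edge G * R * R) : set gpoint :=
  [set chart s.1.1 t | t in `]s.1.2, s.2[].

(* A is a subgraph of a subdivision of G, with vertices P and open edges
   S, where (e, a, b) in S stands for the open segment ]a, b[ of e. *)
Definition subgraph_structure (A : set gpoint) (P : seq gpoint)
    (S : seq (edge G * R * R)) : Prop :=
  [/\ uniq P /\ uniq S,
      forall s, s \in S ->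
        [/\ 0 <= s.1.2, s.1.2 < s.2, s.2 <= len s.1.1,
            chart s.1.1 s.1.2 \in P & chart s.1.1 s.2 \in P],
      forall s p, s \in S -> p \in P -> ~ open_cell s p,
      forall s s' p, s \in S -> s' \in S ->
        open_cell s p -> open_cell s' p -> s = s' &
      A = [set p | p \in P \/ exists2 s, s \in S & open_cell s p]].

(* b = 1 - (Euler characteristic): only meaningful for connected A. *)
Definition has_betti1 (A : set gpoint) (b : nat) : Prop :=
  exists P S, subgraph_structure A P S /\ (b + size P = size S + 1)%N.

Definition subcurve_of_genus (g : vert G -> nat) (n : nat) (A : set gpoint) :
    Prop :=
  connected A /\
  exists2 b, has_betti1 A b & (b + \sum_(v | vpoint v \in A) g v = n)%N.

End Realisation.

Definition half_integer (R : realType) : set R :=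
  [set c | exists n : int, c = n%:~R / 2].

(* The tropicalisation psi : Gamma -> Gamma_T of a weighted hyperelliptic
   admissible cover of genus two. A vertex of cov_source (resp. cov_target) is
   an irreducible component of C (resp. T), an edge is a node; cov_deg v is the
   degree of psi on the component v, cov_exp e the ramification order at the
   node e, and cov_ram i the component of C carrying the i-th point of D_R, so
   that the i-th point of D_B lies on cov_v (cov_ram i). The components of T
   are rational. *)
Record admissible_cover (R : realType) := AdmissibleCover {
  cov_source : metric_graph R;
  cov_target : metric_graph R;
  cov_genus : vert cov_source -> nat;
  cov_weight : vert cov_source -> nat;
  cov_v : vert cov_source -> vert cov_target;
  cov_e : edge cov_source -> edge cov_target;
  cov_deg : vert cov_source -> nat;
  cov_exp : edge cov_source -> nat;
  cov_ram : 'I_6 -> vert cov_source;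

  cov_target_connected : graph_connected cov_target;
  cov_target_tree : #|vert cov_target| = (#|edge cov_target| + 1)%N;

  cov_source_connected : graph_connected cov_source;
  cov_source_genus : (#|edge cov_source| + 1 + \sum_v cov_genus v
                      = #|vert cov_source| + 2)%N;

  cov_src : forall e, src (cov_e e) = cov_v (src e);
  cov_tgt : forall e, tgt (cov_e e) = cov_v (tgt e);
  cov_len : forall e, len (cov_e e) = (cov_exp e)%:R * len e;

  cov_deg_gt0 : forall v, (0 < cov_deg v)%N;
  cov_exp_12 : forall e, (cov_exp e == 1%N) || (cov_exp e == 2%N);
  cov_degree2 : forall u, (\sum_(v | cov_v v == u) cov_deg v = 2)%N;
  cov_harmonic_src : forall v e', src e' = cov_v v ->
    (\sum_(e | (cov_e e == e') && (src e == v)) cov_exp e = cov_deg v)%N;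
  cov_harmonic_tgt : forall v e', tgt e' = cov_v v ->
    (\sum_(e | (cov_e e == e') && (tgt e == v)) cov_exp e = cov_deg v)%N;

  (* Riemann-Hurwitz for each component v -> cov_v v: psi is simply ramified
     along D_R, has order cov_exp at the nodes, and is etale elsewhere; this is
     2 g(v) - 2 = - 2 cov_deg v + (number of ramification points). *)
  cov_ram_deg : forall i, cov_deg (cov_ram i) = 2%N;
  cov_riemann_hurwitz : forall v,
    (2 * cov_genus v + 2 * cov_deg v =
     2 + #|[set i | cov_ram i == v]%SET|
       + \sum_(e | src e == v) (cov_exp e).-1
       + \sum_(e | tgt e == v) (cov_exp e).-1)%N;

  cov_weight_neq0 : exists v, (cov_weight v != 0)%N;
  cov_stable : forall u : vert cov_target,
    (\sum_(v | cov_v v == u) cov_weight v = 0)%N ->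
    (3 <= #|tangent (vpoint u)| + #|[set i | cov_v (cov_ram i) == u]%SET|)%N }.

Section Lambda.
Variables (R : realType) (X : admissible_cover R).
Let G := cov_source X.
Let T := cov_target X.

Definition trop_map (x : gpoint G) : gpoint T :=
  match val x with
  | inl v => vpoint (cov_v v)
  | inr (e, t) => chart (cov_e e) ((cov_exp e)%:R * t)
  end.

Definition ramified_edge (e' : edge T) : bool :=
  [exists e : edge G, (cov_e e == e') && (cov_exp e == 2%N)].

(* The degree at p of the branch divisor of the restriction of the cover over
   the subcurve A of T: the points of D_B, and the nodes at which A is cut off
   from the rest of T and over which psi is ramified (such a node is a smooth
   branch point of A). *)
Definition branch_degree (A : set (gpoint T)) (p : gpoint T) : nat :=
  (match val p with
   | inl u => #|[set i | cov_v (cov_ram X i) == u]%SET|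
   | inr _ => 0
   end
   + #|[set d in tangent p | ramified_edge d.1 && ~~ `[< dir_in A p d >]]%SET|)%N.

(* val - 2 + 1/2 deg D_B, with valences computed in A. *)
Definition Dprime (A : set (gpoint T)) (p : gpoint T) : R :=
  (#|[set d in tangent p | `[< dir_in A p d >]]%SET|)%:R - 2
  + (branch_degree A p)%:R / 2.

Definition admissible_function (v0 : vert T) (f : gpoint T -> R) : Prop :=
  piecewise_linear (@half_integer R) f /\
  forall p, Dprime setT p + pldiv f p = (p == vpoint v0)%:R.

Definition normalised (f : gpoint T -> R) : Prop :=
  (forall v : vert G, 0 < f (trop_map (vpoint v)) -> cov_weight v = 0%N) /\
  (1 <= \sum_(v : vert G | (0 <= f (trop_map (vpoint v)))%R) cov_weight v)%N.

(* In what follows l u is the normalised admissible function, on the target,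
   attached to the vertex u. *)
Variable l : vert T -> gpoint T -> R.

Definition lambdaT (p : gpoint T) : R := \big[Num.max/0]_(u : vert T) l u p.

Definition lambda (x : gpoint G) : R := lambdaT (trop_map x).

Definition Delta : set (gpoint G) :=
  smallest (subcurve_of_genus (@cov_genus R X) 2) (closure [set x | 0 < lambda x]).

Definition DeltaT : set (gpoint T) := trop_map @` Delta.

Definition special_divisor (p : gpoint T) : R := Dprime DeltaT p + pldiv lambdaT p.

Definition special_target : set (gpoint T) :=
  [set p | DeltaT p /\ special_divisor p != 0].

Definition special : set (gpoint G) := trop_map @^-1` special_target.

End Lambda.

(* Main.v *)
Require Import Defs.
From HB Require Import structures.
From mathcomp Require Import all_boot all_order all_algebra.
From mathcomp Require Import all_classical all_reals all_analysis.
From mathcomp Require Import zify ring lra.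
Local Open Scope classical_set_scope.
Local Open Scope ring_scope.

Set Implicit Arguments.
Unset Strict Implicit.
Unset Printing Implicit Defensive.
Import Order.TTheory GRing.Theory Num.Theory.
Import numFieldNormedType.Exports.

(* Cutting an edge of the tree, oriented as [d], leaves [n] of the six branch
   points beyond it, and the admissible function of the vertex [u] has slope
   [n/2 - 1] along [d] if [u] is not beyond [d], and [n/2 - 2] otherwise. If
   [rho1 = 0] the superlevel set is the whole graph. If [rho1 > 0], let [p] be
   the image of the special point: the divisor can only be nonzero at [p] if no
   direction [d] at [p] has all functions active at [p] attached to vertices
   beyond [d]. Hence on every branch at [p] the function [lambdaT], where
   positive, is an active function with slopes [n/2 - 1] away from [p]. As [n]
   decreases away from [p], it is concave along the branch, so the superlevel
   set retracts onto the fibre of [p]. If this fibre has two points, the cover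
   is unramified at [p] and by Riemann-Hurwitz each [n] there is even; following
   a branch with [n >= 2], along which the function does not decrease, one
   reaches a point with a single preimage, and the two lifts of the path join
   the two points of the fibre. *)

(** * Metric trees *)

Section Darts.
Variables (R : realType) (T : metric_graph R).
Implicit Types (d : edge T * bool) (e : edge T) (v w : vert T).

Definition tail d := if d.2 then tgt d.1 else src d.1.
Definition head d := if d.2 then src d.1 else tgt d.1.
Definition reverse d := (d.1, ~~ d.2).

Lemma reverseK : involutive reverse.
Proof. by move=> [e b]; rewrite /reverse /= negbK. Qed.

Lemma tail_reverse d : tail (reverse d) = head d.
Proof. by case: d => e []. Qed.

Lemma head_reverse d : head (reverse d) = tail d.
Proof. by case: d => e []. Qed.

Lemma same_edge d d' : d.1 = d'.1 -> d = d' \/ d = reverse d'.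
Proof.
by case: d d' => e [] [e' []] /= ->; rewrite /reverse /=; [left|right|right|left].
Qed.

Lemma mem_tangent_vpoint d v : (d \in tangent (vpoint v)) = (tail d == v).
Proof. by rewrite inE. Qed.

Definition crosses e (S : pred (vert T)) := S (src e) != S (tgt e).

Definition adj_avoiding (e0 : edge T) : rel (vert T) := fun v w =>
  [exists e, (e != e0) && (((src e == v) && (tgt e == w)) ||
                           ((src e == w) && (tgt e == v)))].

Definition beyond d : pred (vert T) := fingraph.connect (adj_avoiding d.1) (head d).

Lemma connect_uncrossed (r : rel (vert T)) (S : pred (vert T)) v w :
  (forall x y, r x y -> S x = S y) -> fingraph.connect r v w -> S v = S w.
Proof.
move=> rS /connectP[p + ->]; elim: p v => //= x p IH v /andP[/rS -> xp].
exact: IH.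
Qed.

Lemma adj_avoiding_sym e0 : symmetric (adj_avoiding e0).
Proof.
by move=> v w; apply/existsP/existsP => -[e /andP[ee0 H]]; exists e;
  rewrite ee0 orbC.
Qed.

Lemma head_beyond d : beyond d (head d).
Proof. exact: connect0. Qed.

Lemma beyond_uncrossed d e : e != d.1 -> ~~ crosses e (beyond d).
Proof.
move=> ed; rewrite /crosses /beyond negbK; apply/eqP.
have st : fingraph.connect (adj_avoiding d.1) (src e) (tgt e).
  by apply: connect1; apply/existsP; exists e; rewrite ed !eqxx.
exact: (same_connect_r (sym_connect_sym (@adj_avoiding_sym d.1)) st).
Qed.

(* Growing S one vertex at a time consumes a new edge at each step. *)
Lemma spanning_edges (F : pred (edge T)) :
    (forall S : pred (vert T), (exists v, S v) -> (exists v, ~~ S v) ->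
       exists2 e, F e & crosses e S) ->
  (#|vert T| <= #|F|.+1)%N.
Proof.
move=> cF; case: (posnP #|vert T|) => [->//|/card_gt0P[v0 _]].
have T0 : (0 < #|vert T|)%N by apply/card_gt0P; exists v0.
suff grow k : (k < #|vert T|)%N ->
    exists (S : {set vert T}) (H : {set edge T}),
     [/\ #|S| = k.+1, #|H| = k, {subset H <= F} &
        forall e, e \in H -> (src e \in S) && (tgt e \in S)].
  have [|S [H [_ SF HF HS]]] := grow #|vert T|.-1; first lia.
  by have /fintype.subsetP/subset_leq_card := HF; lia.
elim: k => [_|k IH kT].
  exists [set v0]%SET, (finset.set0); rewrite cards1 cards0.
  by split => // e; rewrite finset.in_set0.
have [S [H [cS cH HF HS]]] := IH (ltnW kT).
have [v vS] : exists v, v \in S by apply/card_gt0P; rewrite cS.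
have [w wS] : exists w, w \notin S.
  apply/existsP; rewrite -negb_forall; apply/negP => /forallP allS.
  have : #|S| = #|vert T| by apply: eq_card => x; rewrite allS inE.
  lia.
have [||e Fe eS] := cF (fun v => v \in S); [by exists v|by exists w|].
have eH : e \notin H.
  by apply/negP => /HS /andP[s t]; move: eS; rewrite /crosses s t.
have [x [xS xe]] : exists x, x \notin S /\
    ((src e \in x |: S) && (tgt e \in x |: S))%SET.
  move: eS; rewrite /crosses.
  case sS: (src e \in S); case tS: (tgt e \in S) => // _.
    by exists (tgt e); rewrite !inE eqxx sS tS orbT.
  by exists (src e); rewrite !inE eqxx sS tS orbT.
exists (x |: S)%SET, (e |: H)%SET; split.
- by rewrite cardsU1 xS cS.
- by rewrite cardsU1 eH cH.
- by move=> e'; rewrite !inE => /orP[/eqP ->|/HF].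
move=> e'; rewrite !inE => /orP[/eqP ->|/HS /andP[-> ->]].
  by move: xe; rewrite !inE.
by rewrite !orbT.
Qed.

Hypothesis T_connected : graph_connected T.

(** The cut argument behind the separation statements below: a suitable [S] is chosen, and the few
    edges where it could change are examined separately. *)
Lemma uncrossed_all (S : pred (vert T)) v w :
  (forall e, ~~ crosses e S) -> S v -> S w.
Proof.
move=> nS Sv; rewrite -(connect_uncrossed _ (T_connected v w)) // => x y.
case/existsP => e; have := nS e; rewrite /crosses negbK => /eqP ee.
by case/orP => /andP[/eqP <- /eqP <-].
Qed.

Hypothesis T_tree : #|vert T| = (#|edge T| + 1)%N.

(** If the tail were still reachable, [T] would stay connected without the edge [d.1]. This
    contradicts [spanning_edges], since a tree has exactly one edge fewer than vertices. *)
Lemma tail_beyond d : ~~ beyond d (tail d).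
Proof.
apply/negP => dt.
have := @spanning_edges (predC1 d.1).
suff H : forall S : pred (vert T), (exists v, S v) -> (exists v, ~~ S v) ->
    exists2 e, predC1 d.1 e & crosses e S.
  move=> /(_ H); rewrite T_tree cardC1.
  have : (0 < #|edge T|)%N by apply/card_gt0P; exists d.1.
  lia.
move=> S [v Sv] [w Sw]; apply: contrapT => nex.
have nex' e : e != d.1 -> ~~ crosses e S.
  by move=> ed; apply/negP => eS; apply: nex; exists e.
have ht : S (head d) = S (tail d).
  apply: (connect_uncrossed _ dt) => x y /existsP[e /andP[ed]].
  have := nex' _ ed; rewrite /crosses negbK => /eqP ee.
  by case/orP => /andP[/eqP <- /eqP <-].
suff : S w by rewrite (negbTE Sw).
apply: (@uncrossed_all S v w) => // e; have [->|/nex' //] := eqVneq e d.1.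
by move: ht; rewrite /crosses /head /tail negbK; case: d.2 => ->.
Qed.

Lemma head_neq_tail d : head d != tail d.
Proof. by apply/eqP => ht; have := tail_beyond d; rewrite -ht head_beyond. Qed.

Lemma crosses_andP e (S S' : pred (vert T)) :
  crosses e (fun v => S v && S' v) -> crosses e S \/ crosses e S'.
Proof. by rewrite /crosses; case: (S _); case: (S' _); case: (S _); case: (S' _); auto. Qed.

Lemma uncrossed_dart d (S : pred (vert T)) :
  S (head d) = S (tail d) -> ~~ crosses d.1 S.
Proof. by rewrite /crosses /head /tail negbK; case: d.2 => ->. Qed.

Lemma beyond_dart d d' : d'.1 != d.1 -> beyond d (head d') = beyond d (tail d').
Proof.
move/beyond_uncrossed; rewrite /crosses negbK /head /tail => /eqP.
by case: d'.2.
Qed.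

(** Neither the overlap of the two sides nor the complement of their union contains an end of [d.1],
    and no other edge crosses them. By [uncrossed_all] both are empty. *)
Lemma beyond_reverse d w : beyond (reverse d) w = ~~ beyond d w.
Proof.
have hr := head_beyond (reverse d); have tr := tail_beyond (reverse d).
rewrite head_reverse tail_reverse in hr tr.
have := head_beyond d; have := tail_beyond d => td hd.
apply/idP/idP => [rw|].
- apply/negP => dw.
  suff : beyond d (tail d) && beyond (reverse d) (tail d).
    by rewrite (negbTE td).
  apply: (@uncrossed_all (fun v => beyond d v && beyond (reverse d) v) w);
    last by rewrite dw.
  move=> e; have [->|ed] := eqVneq e d.1.
    by apply: uncrossed_dart; rewrite (negbTE td) (negbTE tr) andbF.
  by apply/negP => /crosses_andP[]; apply/negP; exact: beyond_uncrossed.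
- apply: contraNT => rw; apply/negPn/negP => dw.
  suff : ~~ beyond d (tail d) && ~~ beyond (reverse d) (tail d).
    by rewrite hr andbF.
  apply: (@uncrossed_all (fun v => ~~ beyond d v && ~~ beyond (reverse d) v) w);
    last by rewrite dw rw.
  move=> e; have [->|ed] := eqVneq e d.1.
    by apply: uncrossed_dart; rewrite hd hr andbF.
  have := @beyond_uncrossed (reverse d) e ed; have := beyond_uncrossed ed.
  by rewrite /crosses !negbK => /eqP -> /eqP ->.
Qed.

Lemma beyond_disjoint_tail d d' w :
  tail d = tail d' -> d != d' -> beyond d w -> ~~ beyond d' w.
Proof.
move=> tt dd' dw; apply/negP => d'w.
(* Distinct darts with a common tail on a single edge would make it a loop. *)
have ee : d.1 != d'.1.
  apply/eqP => /same_edge[/eqP|dE]; first by rewrite (negbTE dd').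
  by have := head_neq_tail d'; rewrite -tt dE tail_reverse eqxx.
have td := tail_beyond d; have td' := tail_beyond d'.
suff : beyond d (tail d) && beyond d' (tail d) by rewrite (negbTE td).
apply: (@uncrossed_all (fun v => beyond d v && beyond d' v) w);
  last by rewrite dw.
move=> e; have [->|ed] := eqVneq e d.1.
  by apply: uncrossed_dart; rewrite (beyond_dart ee) tt (negbTE td') !andbF.
have [->|ed'] := eqVneq e d'.1.
  apply: uncrossed_dart; rewrite (@beyond_dart d d') 1?eq_sym//.
  by rewrite -tt (negbTE td).
by apply/negP => /crosses_andP[]; apply/negP; exact: beyond_uncrossed.
Qed.

(** The covered vertices are closed under a step along any dart: the step leaves [v], returns to
    [v], or stays beyond the same dart. *)
Lemma beyond_cover_tail v w :
  w = v \/ exists2 d, tail d = v & beyond d w.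
Proof.
suff /orP[/eqP|/existsP[d /andP[/eqP]]] :
    (w == v) || [exists d, (tail d == v) && beyond d w]; [by left| |].
  by move=> dv dw; right; exists d.
apply: (@uncrossed_all (fun w => (w == v) ||
  [exists d, (tail d == v) && beyond d w]) v); last by rewrite eqxx.
pose S w := (w == v) || [exists d, (tail d == v) && beyond d w].
suff step d : S (tail d) -> S (head d).
  move=> e; rewrite /crosses negbK; apply/eqP.
  by apply/idP/idP; [exact: (step (e, false))|exact: (step (e, true))].
case/orP => [/eqP dv|/existsP[d' /andP[/eqP d'v d't]]].
  by apply/orP; right; apply/existsP; exists d; rewrite dv eqxx head_beyond.
have [dd'|] := eqVneq d.1 d'.1.
  have [->|->] := same_edge dd'.
    by apply/orP; right; apply/existsP; exists d'; rewrite d'v eqxx head_beyond.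
  by rewrite head_reverse d'v /S eqxx.
move=> /beyond_dart dE; rewrite -dE in d't.
by apply/orP; right; apply/existsP; exists d'; rewrite d'v eqxx.
Qed.

(** Truth values are read as numbers so that summing over the six branch points gives
    [branch_total]; [beyond_partition] gives [branch_beyond_rec] in the same way. *)
Lemma beyond_partition_tail v w :
  ((w == v) + \sum_(d | tail d == v) beyond d w = 1)%N.
Proof.
have [->|] := eqVneq w v.
  by rewrite big1 // => d /eqP <-; rewrite (negbTE (tail_beyond d)).
have [->|[d dv dw] wv] := beyond_cover_tail v w; first by rewrite eqxx.
rewrite (bigD1 d) ?dv//= dw big1 // => d' /andP[/eqP d'v d'd].
by rewrite (negbTE (beyond_disjoint_tail _ _ dw)) // ?dv ?d'v // eq_sym.
Qed.

Lemma beyond_partition d w :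
  ((beyond d w : nat) =
   (w == head d) + \sum_(d' | (tail d' == head d) && (d' != reverse d)) beyond d' w)%N.
Proof.
have := beyond_partition_tail (head d) w.
rewrite (bigD1 (reverse d)) ?tail_reverse//= beyond_reverse.
by case: beyond => /=; lia.
Qed.

Lemma beyond_next d d' w : tail d' = head d -> d' != reverse d ->
  beyond d' w -> beyond d w.
Proof.
move=> td' d'r d'w; rewrite -[beyond d w]negbK -beyond_reverse.
by apply: (beyond_disjoint_tail _ d'r) => //; rewrite tail_reverse.
Qed.

Lemma card_beyond_next d d' : tail d' = head d -> d' != reverse d ->
  (#|beyond d'| < #|beyond d|)%N.
Proof.
move=> td' d'r; apply: proper_card; apply/properP; split.
  by apply/fintype.subsetP => w; exact: beyond_next.
exists (head d); first exact: head_beyond.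
by rewrite -td'; exact: tail_beyond.
Qed.

(** Induction from the leaves of the tree inwards; it is well founded because the number of vertices
    beyond a dart drops strictly when the dart is continued. *)
Lemma beyond_ind (P : edge T * bool -> Prop) :
  (forall d, (forall d', tail d' = head d -> d' != reverse d -> P d') -> P d) ->
  forall d, P d.
Proof.
move=> IP d; have [n] := ubnP #|beyond d|; elim: n d => // n IH d dn.
apply: IP => d' t r; apply: IH; have := card_beyond_next t r; lia.
Qed.

Lemma tangent_disjoint (p : gpoint T) d d' w :
  d \in tangent p -> d' \in tangent p -> d != d' -> beyond d w -> ~~ beyond d' w.
Proof.
case: p => [[v|[e t]] pP]; rewrite !inE.
  by move=> /eqP dv /eqP d'v; apply: beyond_disjoint_tail; rewrite /tail dv d'v.
move=> /eqP de /eqP d'e dd'.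
have [/eqP|->] := @same_edge d d' (etrans de (esym d'e)).
  by rewrite (negbTE dd').
by rewrite beyond_reverse.
Qed.

Lemma tangent_cover (p : gpoint T) w :
  vpoint w = p \/ exists2 d, d \in tangent p & beyond d w.
Proof.
case: p => [[v|[e t]] pP].
  have [->|[d dv dw]] := beyond_cover_tail v w; first by left; exact: val_inj.
  by right; exists d => //; rewrite inE; apply/eqP.
right; have [w1|w1] := boolP (beyond (e, false) w).
  by exists (e, false) => //; rewrite inE.
by exists (e, true); rewrite ?inE// (beyond_reverse (e, false)).
Qed.

End Darts.

(** * Piecewise linear functions along darts *)

Section Points.
Variables (R : realType) (T : metric_graph R).
Implicit Types (d : edge T * bool) (e : edge T) (v w : vert T) (p : gpoint T).

Definition is_interior p : bool := if val p is inr _ then true else false.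

Lemma chart_src e (t : R) : t <= 0 -> chart e t = vpoint (src e).
Proof.
move=> t0; rewrite /chart /insubd insubF ?t0 //=.
by apply/negP => /andP[]; rewrite ltNge t0.
Qed.

Lemma chart_tgt e (t : R) : len e <= t -> chart e t = vpoint (tgt e).
Proof.
move=> lt; rewrite /chart /insubd insubF /=.
  by rewrite leNgt (lt_le_trans (len_gt0 e) lt).
by apply/negP => /andP[_]; rewrite ltNge lt.
Qed.

Lemma val_chart e (t : R) : 0 < t < len e -> val (chart e t) = inr (e, t).
Proof. by move=> te; rewrite /chart val_insubd /= te. Qed.

Definition dart_point d (r : R) : gpoint T :=
  chart d.1 (if d.2 then len d.1 - r else r).

Lemma dart_point0 d : dart_point d 0 = vpoint (tail d).
Proof.
rewrite /dart_point /tail; case: d.2; first by rewrite subr0 chart_tgt.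
by rewrite chart_src.
Qed.

Lemma dart_point_len d : dart_point d (len d.1) = vpoint (head d).
Proof.
rewrite /dart_point /head; case: d.2; first by rewrite subrr chart_src.
by rewrite chart_tgt.
Qed.

Lemma dart_point_reverse d r :
  dart_point (reverse d) r = dart_point d (len d.1 - r).
Proof. by case: d => e [] /=; rewrite /dart_point /= ?subKr. Qed.

(** Meaningful only for [d] tangent at [p]: such a dart starts at [p] when [p] is a vertex, whence
    the value 0 there. *)
Definition offset p d : R :=
  match val p with
  | inl _ => 0
  | inr (_, t) => if d.2 then len d.1 - t else t
  end.

Lemma advanceE p d h : d \in tangent p ->
  advance p d h = dart_point d (offset p d + h).
Proof.
case: p => [[v|[e t]] pP]; rewrite !inE /advance /dart_point /offset /= => _;
  case: d.2; congr chart; ring.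
Qed.

Lemma offset_bounds p d : d \in tangent p -> 0 <= offset p d < len d.1.
Proof.
case: p => [[v|[e t]] pP]; rewrite !inE /offset /=.
  by rewrite lexx len_gt0.
by move=> /eqP de; move: pP; rewrite /= -de => /andP[]; case: d.2; lra.
Qed.

Lemma dart_point_offset p d : d \in tangent p -> dart_point d (offset p d) = p.
Proof.
case: p => [[v|[e t]] pP]; rewrite !inE /offset /=.
  by move=> /eqP dv; rewrite dart_point0 /tail dv; exact: val_inj.
move=> /eqP de; apply: val_inj; rewrite /dart_point /=.
have -> : (if d.2 then len d.1 - (if d.2 then len d.1 - t else t)
  else if d.2 then len d.1 - t else t) = t by case: d.2; rewrite ?subKr.
by rewrite val_chart de.
Qed.

Lemma near_right_lt (a b s s' : R) : a < b ->
  \forall h \near (0 : R)^'+, a + s * h < b + s' * h.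
Proof.
(* The summand 1 keeps [m] positive when the two slopes agree. *)
move=> ab; pose m := `|s - s'| + 1.
have m0 : 0 < m by rewrite /m; have := normr_ge0 (s - s'); lra.
have e0 : 0 < (b - a) / m by rewrite divr_gt0 // subr_gt0.
near=> h.
have h0 : 0 < h by near: h; exact: nbhs_right_gt.
have : h < (b - a) / m by near: h; exact: nbhs_right_lt.
rewrite ltr_pdivlMr // => hm.
have := ler_norm (s - s'); rewrite /m in hm; nra.
Unshelve. all: by end_near. Qed.

Lemma slope_near (f : gpoint T -> R) p d c :
  (\forall h \near (0 : R)^'+, f (advance p d h) = f p + c * h) ->
  slope f p d = c.
Proof.
move=> fE; apply: lim_near_cst => //.
near=> h; have h0 : 0 < h by near: h; exact: nbhs_right_gt.
have -> : f (advance p d h) = f p + c * h by near: h.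
by rewrite addrC addKr mulfK // gt_eqF.
Unshelve. all: by end_near. Qed.

Lemma tangent_offset_near p d : d \in tangent p ->
  \forall h \near (0 : R)^'+, 0 <= offset p d + h <= len d.1.
Proof.
move=> /offset_bounds /andP[p0 pl]; near=> h.
have h0 : 0 < h by near: h; exact: nbhs_right_gt.
have : h < len d.1 - offset p d by near: h; apply: nbhs_right_lt; lra.
by move=> hl; apply/andP; split; lra.
Unshelve. all: by end_near. Qed.

Definition affine_along (f : gpoint T -> R) d (c : R) :=
  forall r, 0 <= r <= len d.1 -> f (dart_point d r) = f (vpoint (tail d)) + c * r.

Lemma affine_along_reverse f d c :
  affine_along f d c -> affine_along f (reverse d) (- c).
Proof.
move=> fc r /andP[r0 rl]; rewrite dart_point_reverse fc; last by lra.
rewrite tail_reverse -dart_point_len fc ?(ltW (len_gt0 _)) ?lexx //; ring.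
Qed.

Lemma affine_along_slope f p d c : d \in tangent p ->
  affine_along f d c -> slope f p d = c.
Proof.
move=> dp fc; apply: slope_near; near=> h.
have h0 : 0 < h by near: h; exact: nbhs_right_gt.
rewrite advanceE // fc; last by near: h; exact: tangent_offset_near.
rewrite -[in RHS](dart_point_offset dp) fc; last first.
  by have /andP[-> /ltW] := offset_bounds dp.
ring.
Unshelve. all: by end_near. Qed.

(* A kink at [a] would contribute to the divisor of [f]. *)
Lemma no_kink (f : gpoint T -> R) e (a b c c' : R) :
  (forall p, is_interior p -> pldiv f p = 0) ->
  0 < a -> a < b -> b <= len e ->
  (forall t, 0 <= t <= a -> f (chart e t) = f (chart e 0) + c * t) ->
  (forall t, a <= t <= b -> f (chart e t) = f (chart e a) + c' * (t - a)) ->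
  c' = c.
Proof.
move=> f0 a0 ab bl fa fb.
have ae : 0 < a < len e by apply/andP; split; lra.
have /f0 : is_interior (chart e a).
  by rewrite /is_interior val_chart.
rewrite /pldiv.
have -> : tangent (chart e a) = [set (e, false); (e, true)]%SET.
  by apply/setP => -[e' []]; rewrite /tangent val_chart // !inE !xpair_eqE /=
    ?andbT ?andbF ?orbF ?orFb.
rewrite big_setU1 ?inE ?xpair_eqE ?eqxx //= big_set1.
have -> : slope f (chart e a) (e, false) = c'.
  apply: slope_near; near=> h.
  have h0 : 0 < h by near: h; exact: nbhs_right_gt.
  have hb : h < b - a by near: h; apply: nbhs_right_lt; lra.
  rewrite /advance val_chart //= fb; last by apply/andP; split; lra.
  by congr (_ + _); ring.
have -> : slope f (chart e a) (e, true) = - c.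
  apply: slope_near; near=> h.
  have h0 : 0 < h by near: h; exact: nbhs_right_gt.
  have hb : h < a by near: h; apply: nbhs_right_lt; lra.
  rewrite /advance val_chart //= fa; last by apply/andP; split; lra.
  by rewrite [in RHS]fa; [ring|apply/andP; split; lra].
lra.
Unshelve. all: by end_near. Qed.

Lemma edge_affine (Sl : set R) (f : gpoint T -> R) :
  piecewise_linear Sl f ->
  (forall p, is_interior p -> pldiv f p = 0) ->
  forall e, exists c, forall t, 0 <= t <= len e ->
    f (chart e t) = f (chart e 0) + c * t.
Proof.
move=> fPL f0 e; have [s [sp sl sf]] := fPL e.
(* Induction over the break points: the initial stretch from 0 to [a], of slope [c], is prolonged
   one segment at a time, [no_kink] forcing the next slope to be [c] again. The condition [0 < a]
   makes [a] an interior point whenever a segment follows. *)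
have extend : forall (s : seq R) a c, path <%R a s -> last a s = len e -> 0 < a ->
    (forall t, 0 <= t <= a -> f (chart e t) = f (chart e 0) + c * t) ->
    (forall i, (i < size s)%N ->
          let a' := nth 0 (a :: s) i in let b := nth 0 s i in
          exists2 c, Sl c &
            forall t, a' <= t <= b -> f (chart e t) = f (chart e a') + c * (t - a')) ->
    forall t, 0 <= t <= len e -> f (chart e t) = f (chart e 0) + c * t.
  elim=> [|b s' IH] a c /=; first by move=> _ <-.
  move=> /andP[ab bs] bl a0 fa fs.
  have ble : b <= len e.
    rewrite -bl; case: s' bs {IH bl fs} => //= b' s' /andP[bb' /(order_path_min lt_trans)].
    move=> /allP H; apply/ltW; have := mem_last b' s'; rewrite inE.
    by case/orP => [/eqP ->//|/H]; apply: lt_trans.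
  have [c' _ /= fb] := fs 0%N isT.
  have cc : c' = c by apply: (no_kink f0 a0 ab ble fa fb).
  apply: (IH b c bs bl (lt_trans a0 ab)) => [t /andP[t0 tb]|i si].
    have [ta|/ltW at_] := leP t a; first by apply: fa; rewrite t0.
    rewrite fb ?at_ // fa ?(ltW a0) ?lexx // cc; ring.
  exact: (fs i.+1).
case: s sp sl sf => [_ /= /eqP|b s /= /andP[b0 bs] bl fs].
  by rewrite lt_eqF // len_gt0.
have [c _ /= fb] := fs 0%N isT; exists c; apply: (extend s b c bs bl b0).
  by move=> t /fb ->; rewrite subr0.
by move=> i si; exact: (fs i.+1).
Qed.

Lemma dart_affine (Sl : set R) (f : gpoint T -> R) :
  piecewise_linear Sl f ->
  (forall p, is_interior p -> pldiv f p = 0) ->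
  forall d, exists c, affine_along f d c.
Proof.
move=> fPL f0 [e b]; have [c fc] := edge_affine fPL f0 e.
have fe : affine_along f (e, false) c.
  by move=> r re; rewrite /dart_point /= fc // chart_src.
by case: b; [exists (- c); exact: (affine_along_reverse fe)|exists c].
Qed.

End Points.

(** * Slopes of admissible functions *)

Section Slopes.
Variables (R : realType) (X : admissible_cover R).
Let T := cov_target X.
Let connT : graph_connected T := @cov_target_connected R X.
Let treeT : #|vert T| = (#|edge T| + 1)%N := @cov_target_tree R X.
Implicit Types (d : edge T * bool) (u v w : vert T) (p : gpoint T).

Definition branch_at v : nat := (\sum_(i < 6) (cov_v (cov_ram X i) == v))%N.

Definition branch_beyond d : nat := (\sum_(i < 6) beyond d (cov_v (cov_ram X i)))%N.

Lemma branch_atE v : #|[set i | cov_v (cov_ram X i) == v]%SET| = branch_at v.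
Proof.
by rewrite -sum1_card big_mkcond /=; apply: eq_bigr => i _; rewrite inE; case: ifP.
Qed.

Lemma branch_beyond_rec d : (branch_beyond d = branch_at (head d) +
  \sum_(d' | (tail d' == head d) && (d' != reverse d)) branch_beyond d')%N.
Proof.
rewrite exchange_big /= -big_split /=; apply: eq_bigr => i _.
exact: (beyond_partition connT treeT).
Qed.

Lemma branch_total v :
  (branch_at v + \sum_(d | tail d == v) branch_beyond d = 6)%N.
Proof.
rewrite exchange_big /= -big_split /= -[RHS](card_ord 6) -sum1_card.
by apply: eq_bigr => i _; exact: (beyond_partition_tail connT treeT).
Qed.

Lemma branch_beyond_reverse d : (branch_beyond d + branch_beyond (reverse d) = 6)%N.
Proof.
rewrite -big_split /= -[RHS](card_ord 6) -sum1_card; apply: eq_bigr => i _.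
by rewrite (beyond_reverse connT treeT); case: beyond.
Qed.

Lemma branch_beyond_next d d' : tail d' = head d -> d' != reverse d ->
  (branch_beyond d' <= branch_beyond d)%N.
Proof.
move=> td rd; rewrite (branch_beyond_rec d) (bigD1 d') /= ?td ?eqxx //; lia.
Qed.

(** When every direction at [p] lies in [A], the valence is the full one and no ramified edge is cut
    off at [p]. *)
Lemma Dprime_full (A : set (gpoint T)) p :
  (forall d, d \in tangent p -> dir_in A p d) -> Dprime A p = Dprime setT p.
Proof.
move=> Ap; rewrite /Dprime /branch_degree.
have E : forall d, d \in tangent p -> `[< dir_in A p d >] = `[< dir_in setT p d >].
  move=> d dp; have -> : `[< dir_in A p d >] by apply/asboolP; exact: Ap.
  by symmetry; apply/asboolP; exact: filterE.
congr (_%:R - 2 + (_ + _)%:R / 2); apply: eq_card => d; rewrite !inE;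
  by case: (boolP (d \in tangent p)) => //= dp; rewrite E.
Qed.

Lemma DprimeT p : Dprime (X := X) setT p =
  #|tangent p|%:R - 2 + (if val p is inl v then branch_at v else 0%N)%:R / 2.
Proof.
rewrite /Dprime /branch_degree.
have E d : `[< dir_in setT p d >] = true by apply/asboolP; exact: filterE.
congr (_%:R - 2 + _%:R / 2).
  by apply: eq_card => d; rewrite !inE E andbT.
rewrite (_ : #|_| = 0%N) ?addn0; last first.
  by apply: eq_card0 => d; rewrite !inE E !andbF.
by case: (val p) => [v|[]//]; rewrite branch_atE.
Qed.

Lemma card_tangent_interior p : is_interior p -> #|tangent p| = 2.
Proof.
case: p => [[v|[e t]] pP] //= _.
have -> : tangent (exist _ (inr (e, t)) pP : gpoint T) = [set (e, false); (e, true)]%SET.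
  by apply/setP => -[e' []]; rewrite /tangent /= !inE !xpair_eqE /=
    ?andbT ?andbF ?orbF ?orFb.
by rewrite cards2 xpair_eqE eqxx.
Qed.

(** An interior point has valence two and carries no branch point, so [Dprime] vanishes there, and
    with it the divisor of [f]: the slope can only change at vertices. *)
Lemma admissible_affine u f d : admissible_function u f ->
  exists c, affine_along f d c.
Proof.
move=> [fPL fD]; apply: (dart_affine fPL) => p pi.
have := fD p; rewrite DprimeT (card_tangent_interior pi).
have -> : (p == vpoint u) = false by apply/eqP => pu; rewrite pu in pi.
case: p pi => [[v|[e t]] pP] //= _; lra.
Qed.

(** By induction, the [n] darts continuing [d] have slopes [branch_beyond d' / 2 - 1]. The divisor
    equation at [head d], which has valence [n + 1] and differs from [u], then determines the slope
    of [d]: the terms in [n] cancel and the branch points add up by [branch_beyond_rec]. *)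
Lemma admissible_slope_away u f d : admissible_function u f -> ~~ beyond d u ->
  affine_along f d ((branch_beyond d)%:R / 2 - 1).
Proof.
move=> fu; elim/(beyond_ind connT treeT): d => d IH ud.
have [c fc] := admissible_affine d fu.
suff <- : c = (branch_beyond d)%:R / 2 - 1 by [].
have [_ /(_ (vpoint (head d)))] := fu.
have -> : (vpoint (head d) == vpoint u) = false.
  by apply/eqP => -[hu]; move: ud; rewrite -hu head_beyond.
rewrite DprimeT /pldiv.
have rh : reverse d \in tangent (vpoint (head d)).
  by rewrite mem_tangent_vpoint tail_reverse.
rewrite (bigD1 (reverse d)) //= (affine_along_slope rh (affine_along_reverse fc)).
rewrite (cardsD1 (reverse d)) rh (branch_beyond_rec d).
set n := #|_|.
have -> : \sum_(i in tangent (vpoint (head d)) | i != reverse d)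
    slope f (vpoint (head d)) i =
    (\sum_(d' | (tail d' == head d) && (d' != reverse d)) branch_beyond d')%N%:R / 2
     - n%:R.
  rewrite natr_sum mulr_suml.
  have -> : n = (\sum_(d' | (tail d' == head d) && (d' != reverse d)) 1)%N.
    by rewrite sum1_card /n; apply: eq_card => d'; rewrite !inE andbC.
  rewrite natr_sum -sumrB; apply: eq_big => [d'|d'].
    by rewrite mem_tangent_vpoint.
  move=> /andP[d't d'r]; apply: affine_along_slope => //.
  move: d't; rewrite mem_tangent_vpoint => /eqP d't.
  by apply: IH => //; apply: contra ud; exact: (beyond_next connT treeT).
rewrite !natrD /=; lra.
Qed.

(** If [u] is beyond [d], the previous lemma applies to the reverse dart. It has the other [6 - n]
    branch points beyond it, and [- ((6 - n)/2 - 1) = n/2 - 2]. *)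
Lemma admissible_slope u f d : admissible_function u f ->
  affine_along f d ((branch_beyond d)%:R / 2 - 1 - (beyond d u)%:R).
Proof.
move=> fu; have [ud|ud] := boolP (beyond d u); last first.
  by rewrite subr0; apply: admissible_slope_away fu ud.
have ur : ~~ beyond (reverse d) u by rewrite (beyond_reverse connT treeT) ud.
have := affine_along_reverse (admissible_slope_away fu ur).
rewrite reverseK.
have := branch_beyond_reverse d => /(congr1 (fun n => n%:R : R)); rewrite natrD => E.
suff -> : (branch_beyond d)%:R / 2 - 1 - true%:R =
  - ((branch_beyond (reverse d))%:R / 2 - 1) :> R by [].
rewrite /=; lra.
Qed.

End Slopes.

(** * Lifting along the cover *)

Section Lifting.
Variables (R : realType) (X : admissible_cover R).
Let G := cov_source X.
Let T := cov_target X.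
Let connT : graph_connected T := @cov_target_connected R X.
Let treeT : #|vert T| = (#|edge T| + 1)%N := @cov_target_tree R X.
Implicit Types (d : edge T * bool) (x : gpoint G).

Lemma cov_exp_gt0 (e : edge G) : 0 < (cov_exp e)%:R :> R.
Proof. by have /orP[] := cov_exp_12 e => /eqP ->. Qed.

Lemma trop_map_chart (e : edge G) (t : R) :
  trop_map (chart e t) = chart (cov_e e) ((cov_exp e)%:R * t).
Proof.
have e0 := cov_exp_gt0 e; have le := cov_len e.
have [t0|t0] := leP t 0.
  by rewrite !chart_src ?pmulr_rle0 // /trop_map /= cov_src.
have [tl|tl] := leP (len e) t.
  by rewrite !chart_tgt ?le ?ler_pM2l // /trop_map /= cov_tgt.
by rewrite /trop_map val_chart // t0.
Qed.

Lemma trop_map_dart_point (e : edge G) (b : bool) (r : R) :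
  trop_map (dart_point (e, b) r) = dart_point (cov_e e, b) ((cov_exp e)%:R * r).
Proof.
rewrite /dart_point trop_map_chart /= cov_len; case: b => //.
by rewrite mulrBr.
Qed.

Lemma interior_trop_map x : is_interior (trop_map x) = is_interior x.
Proof.
case: x => [[v|[e t]] xP] //; rewrite /trop_map /is_interior /= val_chart //.
case/andP: xP => t0 tl; rewrite mulr_gt0 ?cov_exp_gt0 //=.
by rewrite cov_len ltr_pM2l // cov_exp_gt0.
Qed.

Lemma trop_map_vpointP x u : trop_map x = vpoint u ->
  exists2 v : vert G, x = vpoint v & cov_v v = u.
Proof.
move=> xu; have : ~~ is_interior (trop_map x) by rewrite xu.
rewrite interior_trop_map; case: x xu => [[v|[e t]] xP] //= + _.
by rewrite /trop_map /= => -[<-]; exists v => //; exact: val_inj.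
Qed.

(** The local degree at [v] is positive, so the harmonicity sum equal to it has at least one
    term. *)
Lemma lift_dart_tail (v : vert G) d : cov_v v = tail d ->
  exists2 e : edge G, cov_e e = d.1 & tail (e, d.2) = v.
Proof.
case: d => e' [] /= vd.
- have := cov_harmonic_tgt (esym vd); have := cov_deg_gt0 v.
  case: (pickP [pred e | (cov_e e == e') && (tgt e == v)]) => [e|no].
    by move=> /andP[/eqP ee /eqP ev]; exists e.
  by rewrite big_pred0 // => + E; rewrite -E.
- have := cov_harmonic_src (esym vd); have := cov_deg_gt0 v.
  case: (pickP [pred e | (cov_e e == e') && (src e == v)]) => [e|no].
    by move=> /andP[/eqP ee /eqP ev]; exists e.
  by rewrite big_pred0 // => + E; rewrite -E.
Qed.

Lemma lift_dart x d (r : R) : 0 <= r <= len d.1 -> trop_map x = dart_point d r ->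
  exists2 e : edge G, cov_e e = d.1 & x = dart_point (e, d.2) (r / (cov_exp e)%:R).
Proof.
move=> /andP[]; rewrite le_eqVlt => /orP[/eqP <- _|r0].
  rewrite dart_point0 => /trop_map_vpointP[v -> /lift_dart_tail[e ee ev]].
  by exists e => //; rewrite mul0r dart_point0 ev.
rewrite le_eqVlt => /orP[/eqP ->|rl].
  (* At the far end the lift is found from the tail of the reverse dart. *)
  rewrite dart_point_len -tail_reverse.
  move=> /trop_map_vpointP[v -> /lift_dart_tail[e ee ev]].
  rewrite /= in ee; exists e => //=; rewrite -ee cov_len mulrAC divff ?mul1r ?gt_eqF ?cov_exp_gt0 //.
  rewrite (dart_point_len (e, d.2)) -ev.
  by rewrite -[head _]tail_reverse.
move=> xd.
have rI : 0 < (if d.2 then len d.1 - r else r) < len d.1.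
  by case: d.2; apply/andP; split; lra.
have : is_interior (trop_map x) by rewrite xd /is_interior /dart_point val_chart.
rewrite interior_trop_map; case: x xd => [[v|[e t]] xP] //= + _.
move=> /(congr1 val); rewrite /trop_map /= /dart_point.
have /andP[t0 tl] := xP; have e0 := cov_exp_gt0 e.
rewrite val_chart; last by rewrite mulr_gt0 //= cov_len ltr_pM2l.
rewrite val_chart // => -[ed tE]; exists e => //.
apply: val_inj; rewrite /= /dart_point /=.
have -> : (if d.2 then len e - r / (cov_exp e)%:R else r / (cov_exp e)%:R) = t.
  move: tE; rewrite -ed cov_len; case: d.2 => tE.
    by apply: (mulfI (lt0r_neq0 e0)); rewrite tE; field; exact: lt0r_neq0.
  by rewrite -tE mulrC mulKf // gt_eqF.
by rewrite val_chart // t0.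
Qed.

Lemma trop_map_surj (q : gpoint T) : exists x, trop_map x = q.
Proof.
have vsurj u : exists v : vert G, cov_v v = u.
  have := cov_degree2 u.
  case: (pickP [pred v : vert G | cov_v v == u]) => [v /eqP vu|no]; first by exists v.
  by rewrite big_pred0.
case: q => [[u|[e' t]] qP].
  have [v vu] := vsurj u; exists (vpoint v).
  by rewrite /trop_map /= vu; exact: val_inj.
have [v] := vsurj (tail (e', false)).
move=> /lift_dart_tail[e ee _]; exists (chart e (t / (cov_exp e)%:R)).
rewrite trop_map_chart mulrCA divff ?mulr1 ?gt_eqF ?cov_exp_gt0 //.
by apply: val_inj; rewrite val_chart ?ee.
Qed.

(** Two vertices of positive local degree in a fibre of total degree 2 leave degree 1 for each and
    no room for a third. *)
Lemma two_lifts_deg (v1 v2 v : vert G) : cov_v v1 = cov_v v2 -> v1 != v2 ->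
  cov_v v = cov_v v1 -> cov_deg v = 1%N.
Proof.
move=> v12 nv vv; have := cov_degree2 (cov_v v1).
have [v' v'v1 v'v] : exists2 v', cov_v v' = cov_v v1 & v' != v.
  by have [vv1|] := eqVneq v1 v; [exists v2; rewrite ?v12 // -vv1 eq_sym|exists v1].
rewrite (bigD1 v) ?vv //= (bigD1 v') ?v'v1 ?eqxx //=.
have := cov_deg_gt0 v; have := cov_deg_gt0 v'; lia.
Qed.

Lemma cov_exp_le_deg (e : edge G) b : (cov_exp e <= cov_deg (tail (e, b)))%N.
Proof.
case: b; rewrite /tail /=.
- rewrite -(@cov_harmonic_tgt _ _ _ (cov_e e)) ?cov_tgt //.
  by rewrite (bigD1 e) ?eqxx //= leq_addr.
- rewrite -(@cov_harmonic_src _ _ _ (cov_e e)) ?cov_src //.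
  by rewrite (bigD1 e) ?eqxx //= leq_addr.
Qed.

(** It vanishes exactly when the cover is unramified over the edge of [d]; mainly its parity
    matters. *)
Definition ramification d : nat := (\sum_(e : edge G | cov_e e == d.1) (cov_exp e).-1)%N.

(** This is the sum of the Riemann-Hurwitz relations over the vertices above [u], read modulo 2: all
    terms other than the ramification are even. *)
Lemma branch_at_parity (u : vert T) :
  ~~ odd (branch_at u + \sum_(d | tail d == u) ramification d).
Proof.
have bE : branch_at u = (\sum_(v | cov_v v == u) #|[set i | cov_ram X i == v]%SET|)%N.
  under [RHS]eq_bigr do rewrite -sum1_card big_mkcond /=.
  rewrite exchange_big /=; apply: eq_bigr => i _.
  have [iu|iu] := eqVneq (cov_v (cov_ram X i)) u.
    rewrite (bigD1 (cov_ram X i)) ?iu //= inE eqxx big1 // => v /andP[_ vi].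
    by rewrite inE eq_sym (negbTE vi).
  rewrite big1 // => v /eqP vu; rewrite inE; case: eqP => // iv.
  by rewrite iv vu eqxx in iu.
(* After exchanging the sums, both sides count each source edge once for each of its ends lying
   above [u]. *)
have sE : (\sum_(d | tail d == u) ramification d =
    \sum_(v | cov_v v == u) (\sum_(e | src e == v) (cov_exp e).-1
       + \sum_(e | tgt e == v) (cov_exp e).-1))%N.
  rewrite /ramification (exchange_big_dep xpredT) //= [RHS]big_split /=.
  rewrite [X in _ = (X + _)%N](exchange_big_dep xpredT) //=.
  rewrite [X in _ = (_ + X)%N](exchange_big_dep xpredT) //= -[RHS]big_split /=.
  apply: eq_bigr => e _.
  have one (a : vert G) : (\sum_(v | (cov_v v == u) && (a == v)) (cov_exp e).-1 =
      (cov_v a == u) * (cov_exp e).-1)%N.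
    have [au|au] := eqVneq (cov_v a) u.
      rewrite (bigD1 a) ?au ?eqxx //= big1 ?addn0 ?mul1n // => v.
      by move=> /andP[/andP[_ /eqP ->]]; rewrite eqxx.
    rewrite big_pred0 // => v; apply/negP => /andP[/eqP vu /eqP av].
    by rewrite av vu eqxx in au.
  rewrite !one -cov_src -cov_tgt.
  rewrite (eq_bigl (fun d : edge T * bool => (d.1 == cov_e e) && (tail d == u))); last first.
    by move=> d; rewrite andbC eq_sym.
  rewrite -(pair_big_dep (pred1 (cov_e e)) (fun e' b => tail (e', b) == u)
    (fun _ _ => (cov_exp e).-1)) /= big_pred1_eq big_mkcond big_bool /= addnC.
  by rewrite /tail /=; do 2 case: eqP => _; rewrite ?mul1n ?mul0n.
rewrite bE sE -big_split /=; apply: (big_ind (fun n => ~~ odd n)) => //.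
  by move=> a b; rewrite oddD => /negbTE -> /negbTE ->.
move=> v _; have /(congr1 odd) := cov_riemann_hurwitz v.
by rewrite !mul2n !oddD !odd_double /= addbA => <-.
Qed.

(** The parity is carried inwards from the leaves: [branch_at_parity] at [head d] compares the
    incoming edge, whose ramification is the same for [d] and its reverse, with the continuing
    ones. *)
Lemma branch_beyond_parity d : odd (branch_beyond d) = odd (ramification d).
Proof.
elim/(beyond_ind connT treeT): d => d IH.
rewrite branch_beyond_rec; have := branch_at_parity (head d).
rewrite (bigD1 (reverse d)) ?tail_reverse //=.
have : odd (\sum_(d' | (tail d' == head d) && (d' != reverse d)) branch_beyond d') =
   odd (\sum_(d' | (tail d' == head d) && (d' != reverse d)) ramification d').
  apply: (big_ind2 (fun a b => odd a = odd b)) => //.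
    by move=> a b c c' ac bc; rewrite !oddD ac bc.
  by move=> d' /andP[/eqP d't d'r]; exact: IH.
rewrite !oddD [ramification (reverse d)]/(ramification d) => ->.
by case: odd; case: odd; case: odd.
Qed.

(** Both lifts have local degree 1. This excludes ramification points, where the degree is 2, and
    forces expansion factor 1 on all edges above the darts at this vertex, so their ramification is
    zero and the parity lemma applies. *)
Lemma two_lifts_branch (v1 v2 : vert G) :
  cov_v v1 = cov_v v2 -> v1 != v2 ->
  branch_at (cov_v v1) = 0%N /\
  forall d, tail d = cov_v v1 -> ~~ odd (branch_beyond d).
Proof.
move=> v12 nv; split.
  rewrite /branch_at big1 // => i _; case: eqP => // iv.
  by have := two_lifts_deg v12 nv iv; rewrite cov_ram_deg.
move=> [e' b] dt; rewrite branch_beyond_parity /ramification big1 // => e /eqP /= ee.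
have -> : cov_exp e = 1%N; last by [].
have : (cov_exp e <= 1)%N.
  rewrite -(two_lifts_deg v12 nv (v := tail (e, b))); first exact: cov_exp_le_deg.
  by rewrite -dt /tail /= -ee; case: b {dt}; rewrite (cov_src, cov_tgt).
by have /orP[/eqP ->|/eqP ->] := cov_exp_12 e.
Qed.

End Lifting.

(** * Connectedness in a metric graph *)

Section Joining.
Variables (R : realType) (G : metric_graph R).
Implicit Types (S : set (gpoint G)) (e : edge G).

Lemma chart_continuous e : continuous (chart e).
Proof. by apply/continuousP => A oA; exact: oA. Qed.

Lemma join_chart S e (a b : R) :
  (forall t, (a <= t <= b) || (b <= t <= a) -> S (chart e t)) ->
  connected_component S (chart e a) (chart e b).
Proof.
wlog ab : a b / a <= b => [H|] Sab.
  have [ab|/ltW ba] := leP a b; first exact: H.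
  by apply: connected_component_sym; apply: H => // t; rewrite orbC; exact: Sab.
exists (chart e @` `[a, b]); last by exists b => //=; rewrite in_itv /= ab lexx.
split; first by exists a => //=; rewrite in_itv /= ab lexx.
  by move=> _ [t /= + <-]; rewrite in_itv /= => tab; apply: Sab; rewrite tab.
apply: connected_continuous_connected; first exact: segment_connected.
by apply: continuous_subspaceT; exact: chart_continuous.
Qed.

Lemma join_dart S d (r s : R) :
  (forall t, (r <= t <= s) || (s <= t <= r) -> S (dart_point d t)) ->
  connected_component S (dart_point d r) (dart_point d s).
Proof.
case: d => e b; rewrite /dart_point /=; case: b => Srs; apply: join_chart => t tI //.
  by rewrite -(subKr (len e) t); apply: Srs; lra.
exact: Srs.
Qed.

Lemma connectedT_graph : graph_connected G -> connected (setT : set (gpoint G)).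
Proof.
move=> cG; have [v _|noV] := pickP (fun _ : vert G => true); last first.
  have -> : setT = set0 :> set (gpoint G); last exact: connected0.
  by apply/seteqP; split => // -[[v|[e t]] xP] _; [have := noV v|have := noV (src e)].
have -> : setT = connected_component setT (vpoint v); last exact: component_connected.
apply/seteqP; split => // x _.
have edge_join e : connected_component setT (vpoint (src e)) (vpoint (tgt e)).
  by rewrite -(chart_src e (lexx 0)) -(chart_tgt (lexx (len e))); exact: join_chart.
have vert_join w : connected_component setT (vpoint v) (vpoint w).
  have /connectP[s + ->] := cG v w; elim: s v => [|v' s IH] v0 /=.
    by move=> _; exact: connected_component_refl.
  move=> /andP[/existsP[e ve] vs]; apply: connected_component_trans (IH _ vs).
  case/orP: ve => /andP[/eqP <- /eqP <-]; first exact: edge_join.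
  exact: connected_component_sym.
case: x => [[w|[e t]] xP].
  by rewrite (_ : exist _ _ _ = vpoint w); [exact: vert_join|exact: val_inj].
apply: connected_component_trans (vert_join (src e)) _.
rewrite (_ : exist _ _ _ = chart e t); last by apply: val_inj; rewrite val_chart.
by rewrite -(chart_src e (lexx 0)); exact: join_chart.
Qed.

End Joining.

(** * Branches of a tree seen from a point *)

Section Branches.
Variables (R : realType) (T : metric_graph R).
Hypothesis connT : graph_connected T.
Hypothesis treeT : #|vert T| = (#|edge T| + 1)%N.
Implicit Types (d : edge T * bool) (w : vert T) (p q : gpoint T).

(** The points reached from offset [r0] on [d] without turning back. The inductive form records the
    path, so that slopes can be followed one edge at a time. *)
Inductive branch d (r0 : R) : gpoint T -> Prop :=
| Branch_here r : r0 <= r <= len d.1 -> branch d r0 (dart_point d r)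
| Branch_next d' q : tail d' = head d -> d' != reverse d -> branch d' 0 q ->
    branch d r0 q.

Lemma beyond_split d w : beyond d w -> w != head d ->
  exists d', [/\ tail d' = head d, d' != reverse d & beyond d' w].
Proof.
move=> dw wd; have := beyond_partition connT treeT d w.
rewrite dw (negbTE wd) /= add0n => /esym /eqP /sum_nat_eq1[d' [/andP[/eqP d't d'r] d'w _]].
by exists d'; split => //; move: d'w; case: beyond.
Qed.

Lemma branch_vpoint d r0 w : r0 <= len d.1 -> beyond d w -> branch d r0 (vpoint w).
Proof.
elim/(beyond_ind connT treeT): d r0 => d IH r0 rl.
have [->|wd] := eqVneq w (head d).
  by rewrite -dart_point_len => _; apply: Branch_here; rewrite rl lexx.
move=> dw; have [d' [d't d'r d'w]] := beyond_split dw wd.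
by apply: (Branch_next _ d't d'r); apply: IH => //; exact/ltW/len_gt0.
Qed.

(** The last hypothesis is about points on the edge of [d] itself, measured from its head: they must
    not lie before [r0]. *)
Lemma branch_dart_point d r0 d' r : r0 <= len d.1 -> beyond d (tail d') ->
  0 <= r <= len d'.1 -> (d' = reverse d -> r0 <= len d.1 - r) ->
  branch d r0 (dart_point d' r).
Proof.
elim/(beyond_ind connT treeT): d r0 => d IH r0 rl dt rd' d'd.
have [d'r|d'r] := eqVneq d' (reverse d).
  move: (d'd d'r) rd'; rewrite d'r dart_point_reverse /= => r0r /andP[r_ge0 rl'].
  by apply: Branch_here; lra.
have [wd|wd] := eqVneq (tail d') (head d).
  by apply: (Branch_next _ wd d'r); exact: Branch_here.
have [d1 [d1t d1r d1w]] := beyond_split dt wd.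
apply: (Branch_next _ d1t d1r); apply: IH => //; first exact/ltW/len_gt0.
by move=> d'E; move: rd'; rewrite d'E /=; lra.
Qed.

Lemma branch_cover p q :
  q = p \/ exists2 d, d \in tangent p & branch d (offset p d) q.
Proof.
have ol d : d \in tangent p -> offset p d <= len d.1.
  by move=> /offset_bounds /andP[_ /ltW].
case: q => [[w|[e t]] qP].
  rewrite (_ : exist _ _ _ = vpoint w); last exact: val_inj.
  have [->|[d dp dw]] := tangent_cover connT treeT p w; [by left|right].
  by exists d => //; apply: branch_vpoint => //; exact: ol.
have qE : exist _ (inr (e, t)) qP = dart_point (e, false) t :> gpoint T.
  by apply: val_inj; rewrite /dart_point val_chart.
rewrite qE; have /andP[t0 tl] := qP.
have [pw|[d dp dw]] := tangent_cover connT treeT p (src e).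
  right; exists (e, false); first by rewrite -pw inE /=.
  by rewrite -pw /offset /=; apply: Branch_here; rewrite /= !ltW.
have [de|de] := eqVneq d (reverse (e, false)); last first.
  right; exists d => //; apply: branch_dart_point => //; first exact: ol.
    by rewrite /= !ltW.
  by move=> E; move: de; rewrite E reverseK eqxx.
(* Here [d] runs along the edge of [q] towards [src e]. Either [p] is the end [tgt e], or [p] is
   inside the same edge and the two parameters are compared. *)
case: p dp {dw} ol => [[v|[e1 t1]] pP] dp ol.
  right; exists d => //; apply: branch_dart_point => //=.
  - exact: ol.
  - by rewrite de; exact: head_beyond.
  - by rewrite !ltW.
  - by move=> _; rewrite /offset /= de /=; lra.
have e1e : e1 = e by move: dp; rewrite inE de /= => /eqP ->.
subst e1; have [tt1|t1t|tt1] := ltgtP t t1.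
- right; exists (e, true); first by rewrite inE.
  have -> : dart_point (e, false) t = dart_point (e, true) (len e - t).
    by rewrite /dart_point /= subKr.
  by apply: Branch_here; rewrite /offset /=; lra.
- right; exists (e, false); first by rewrite inE.
  by apply: Branch_here; rewrite /offset /=; lra.
- by left; apply: val_inj; rewrite -qE /= tt1.
Qed.

End Branches.

(** * Superlevel sets of lambda *)

Section Special.
Variables (R : realType) (X : admissible_cover R).
Let G := cov_source X.
Let T := cov_target X.
Let connT : graph_connected T := @cov_target_connected R X.
Let treeT : #|vert T| = (#|edge T| + 1)%N := @cov_target_tree R X.
Variable l : vert T -> gpoint T -> R.
Hypothesis l_adm : forall u, admissible_function u (l u).
Implicit Types (d : edge T * bool) (u v w : vert T) (p q : gpoint T).

Definition adm_slope u d : R := (branch_beyond d)%:R / 2 - 1 - (beyond d u)%:R.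

Lemma adm_along u d (r s : R) : 0 <= r <= len d.1 -> 0 <= s <= len d.1 ->
  l u (dart_point d s) = l u (dart_point d r) + adm_slope u d * (s - r).
Proof.
have aff : affine_along (l u) d (adm_slope u d) := @admissible_slope _ _ _ _ d (l_adm u).
by move=> rd sd; rewrite !aff //; ring.
Qed.

Lemma adm_advance u p d : d \in tangent p ->
  \forall h \near (0 : R)^'+, l u (advance p d h) = l u p + adm_slope u d * h.
Proof.
move=> dp; near=> h; rewrite advanceE // (@adm_along _ _ (offset p d)).
- by rewrite dart_point_offset //; congr (_ + _ * _); ring.
- by have /andP[-> /ltW ->] := offset_bounds dp.
- by near: h; exact: tangent_offset_near.
Unshelve. all: by end_near. Qed.

Lemma lambdaT_ge0 p : 0 <= lambdaT l p.
Proof. exact: bigmax_ge_id. Qed.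

Lemma lambdaT_ge u p : l u p <= lambdaT l p.
Proof. exact: le_bigmax. Qed.

Lemma lambdaT_active p : 0 < lambdaT l p -> exists u, l u p = lambdaT l p.
Proof.
move=> lp; have /bigmax_geP[] := lexx (lambdaT l p); first by rewrite leNgt lp.
by move=> [u _ lu]; exists u; apply/eqP; rewrite eq_le lambdaT_ge.
Qed.

Lemma DeltaT_pos p : 0 < lambdaT l p -> DeltaT l p.
Proof.
have [x <-] := trop_map_surj p => lx; exists x => // A [_ sA].
by apply: sA; exact: subset_closure.
Qed.

(* Otherwise all active [l u] have equal slopes at [p], so that [lambdaT]
   coincides near [p] with a single [l u0], whose divisor vanishes at [p]. *)
Lemma special_active p d0 : 0 < lambdaT l p -> special_divisor l p != 0 ->
  d0 \in tangent p -> exists2 u, l u p = lambdaT l p & ~~ beyond d0 u.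
Proof.
move=> lp Dp d0p; apply: contrapT => noU.
have allU u : l u p = lambdaT l p -> beyond d0 u.
  by move=> up; apply/negPn/negP => ud; apply: noU; exists u.
have [u0 u0p] := lambdaT_active lp.
have near_u0 d : d \in tangent p -> \forall h \near (0 : R)^'+,
    0 < l u0 (advance p d h) /\ forall v, l v (advance p d h) <= l u0 (advance p d h).
  move=> dp; near=> h.
  have E v : l v (advance p d h) = l v p + adm_slope v d * h.
    by move: v; near: h; apply: filter_forall => v; exact: adm_advance.
  have lts v : (l v p < l u0 p) ==>
      (l v p + adm_slope v d * h < l u0 p + adm_slope u0 d * h).
    move: v; near: h; apply: filter_forall => v.
    have [vlt|_] := ltP (l v p) (l u0 p); first exact: near_right_lt.
    by apply: nearW.
  have pos : 0 + 0 * h < l u0 p + adm_slope u0 d * h.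
    by near: h; apply: near_right_lt; rewrite u0p.
  split; first by rewrite E; move: pos; rewrite mul0r addr0.
  move=> v; have [vp|vp] := eqVneq (l v p) (lambdaT l p).
    rewrite !E vp u0p.
    (* The slope along [d] depends on the vertex only through whether it is beyond [d]: all active
       vertices are beyond [d0], hence none is beyond another direction at [p]. *)
    suff -> : adm_slope v d = adm_slope u0 d by [].
    rewrite /adm_slope; congr (_ - _%:R); have [->|dd] := eqVneq d d0.
      by rewrite !allU.
    have away w : beyond d0 w -> beyond d w = false.
      by move=> dw; apply/negbTE; apply: (tangent_disjoint connT treeT d0p dp _ dw);
        rewrite eq_sym.
    by rewrite !away // allU.
  have vlt : l v p < l u0 p by rewrite u0p lt_neqAle vp lambdaT_ge.
  by rewrite !E; apply/ltW/(implyP (lts v)).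
have lam_near d : d \in tangent p -> \forall h \near (0 : R)^'+,
    0 < lambdaT l (advance p d h) /\ lambdaT l (advance p d h) = l u0 (advance p d h).
  move=> dp; apply: filterS (near_u0 d dp) => h [h0 hv].
  suff -> : lambdaT l (advance p d h) = l u0 (advance p d h) by [].
  apply/eqP; rewrite eq_le lambdaT_ge andbT; apply: bigmax_le => //.
  exact: ltW.
(* Positivity of [lambdaT] around [p] puts every direction at [p] into [DeltaT], so [Dprime] agrees
   with its value for the whole tree. *)
move: Dp; rewrite /special_divisor (Dprime_full (A := DeltaT l)); last first.
  move=> d dp; apply: filterS (lam_near d dp) => h [h0 _]; exact: DeltaT_pos.
have -> : pldiv (lambdaT l) p = pldiv (l u0) p.
  apply: eq_bigr => d dp.
  rewrite (affine_along_slope dp (@admissible_slope _ _ _ _ d (l_adm u0))).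
  apply: slope_near; apply: filterS2 (lam_near d dp) (adm_advance u0 dp) => h.
  by move=> [_ ->] ->; rewrite u0p.
(* The only point left with nonzero divisor would be [u0] itself, but [u0] is beyond [d0] whereas
   [p] would be its tail. *)
have [_ ->] := l_adm u0; case: (p =P vpoint u0) => [pu _|_]; last by rewrite eqxx.
have := allU _ u0p.
by move: d0p; rewrite pu mem_tangent_vpoint => /eqP <-; rewrite (negbTE (tail_beyond connT treeT d0)).
Unshelve. all: by end_near. Qed.

Lemma adm_slope_le u v d : ~~ beyond d u -> adm_slope v d <= adm_slope u d.
Proof. by move=> ud; rewrite /adm_slope (negbTE ud) lerD2l lerN2 ler0n. Qed.

(** Since [u] is beyond no dart of the branch, [l u] has the largest slope on each of them, and its
    lead at the base point persists. *)
Lemma branch_dominated u v d r0 q : 0 <= r0 <= len d.1 -> ~~ beyond d u ->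
  l v (dart_point d r0) <= l u (dart_point d r0) -> branch d r0 q ->
  l v q <= l u q.
Proof.
move=> + + + bq; elim: bq => {d r0 q} [d r0 r /andP[r0r rl]|d r0 d' q d't d'r bq IH]
    /andP[r0_ge0 r0l] ud vu.
  rewrite !(@adm_along _ d r0 r) ?r0_ge0 ?r0l ?rl ?(le_trans r0_ge0) //.
  by rewrite lerD // ler_wpM2r ?subr_ge0 // adm_slope_le.
apply: IH; first by rewrite lexx ltW ?len_gt0.
  by apply: contra ud; exact: (beyond_next connT treeT).
rewrite dart_point0 d't -dart_point_len.
have dl : 0 <= len d.1 <= len d.1 by rewrite lexx ltW ?len_gt0.
rewrite !(@adm_along _ d r0 (len d.1)) ?r0_ge0 ?r0l //.
by rewrite lerD // ler_wpM2r ?subr_ge0 // adm_slope_le.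
Qed.

Variable rho : R.
Hypothesis rho_gt0 : 0 < rho.
Let S : set (gpoint G) := [set x | rho <= lambda l x].

Lemma lift_segment x d (r s : R) : 0 <= r <= len d.1 -> 0 <= s <= len d.1 ->
  trop_map x = dart_point d r ->
  (forall t, (r <= t <= s) || (s <= t <= r) -> rho <= lambdaT l (dart_point d t)) ->
  exists2 y, trop_map y = dart_point d s & connected_component S x y.
Proof.
move=> rd sd xd seg; have [e ee ->] := lift_dart rd xd.
have e0 := cov_exp_gt0 e.
have dE : d = (cov_e e, d.2) by case: (d) ee => ? ? /= ->.
exists (dart_point (e, d.2) (s / (cov_exp e)%:R)).
  by rewrite trop_map_dart_point -dE mulrCA divff ?mulr1 ?gt_eqF.
apply: join_dart => t tI; rewrite /S /= /lambda trop_map_dart_point -dE.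
apply: seg; move: tI; rewrite !ler_pdivrMr // !ler_pdivlMr //.
by rewrite [t * _]mulrC.
Qed.

Lemma adm_slope_ge0 u d : ~~ beyond d u -> (2 <= branch_beyond d)%N ->
  0 <= adm_slope u d.
Proof.
by move=> ud; rewrite /adm_slope (negbTE ud) subr0 -(ler_nat R); lra.
Qed.

Lemma adm_slope_le0 u d : ~~ beyond d u -> (branch_beyond d < 2)%N ->
  adm_slope u d <= 0.
Proof.
by move=> ud; rewrite /adm_slope (negbTE ud) subr0 ltnS -(ler_nat R); lra.
Qed.

(** On the segment, [l u] is bounded below by its value at the end where it is smaller: the near end
    [r0] if at least two branch points lie beyond, the far end [r] otherwise. The bound at [r0] is
    thus required only in the first case. *)
Lemma edge_descend u d (r0 r : R) x : 0 <= r0 -> r0 <= r -> r <= len d.1 ->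
  ~~ beyond d u -> ((2 <= branch_beyond d)%N -> rho <= l u (dart_point d r0)) ->
  rho <= l u (dart_point d r) -> trop_map x = dart_point d r ->
  exists2 y, trop_map y = dart_point d r0 & connected_component S x y.
Proof.
move=> r0_ge0 r0r rl ud up lur xr.
have r0d : 0 <= r0 <= len d.1 by lra.
have rd : 0 <= r <= len d.1 by lra.
apply: (lift_segment rd r0d xr) => t tI.
have {tI} /andP[r0t tr] : r0 <= t <= r by lra.
have td : 0 <= t <= len d.1 by lra.
apply: le_trans (lambdaT_ge u _).
have [n2|n1] := leqP 2 (branch_beyond d).
  apply: le_trans (up n2) _; rewrite (@adm_along u d r0 t) // lerDl.
  by apply: mulr_ge0; [exact: adm_slope_ge0|rewrite subr_ge0].
apply: le_trans lur _; rewrite (@adm_along u d t r) // gerDl.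
by apply: mulr_le0_ge0; [exact: adm_slope_le0|rewrite subr_ge0].
Qed.

Lemma adm_head_ge u d r0 : 0 <= r0 <= len d.1 -> ~~ beyond d u ->
  (2 <= branch_beyond d)%N -> l u (dart_point d r0) <= l u (vpoint (head d)).
Proof.
move=> r0d ud n2; rewrite -dart_point_len (@adm_along u d r0 (len d.1)) //.
  rewrite lerDl; apply: mulr_ge0; first exact: adm_slope_ge0.
  by rewrite subr_ge0; case/andP: r0d.
by rewrite lexx ltW ?len_gt0.
Qed.

Lemma branch_descend u d r0 q x : 0 <= r0 <= len d.1 -> ~~ beyond d u ->
  (forall q', branch d r0 q' -> rho <= lambdaT l q' -> rho <= l u q') ->
  ((2 <= branch_beyond d)%N -> rho <= l u (dart_point d r0)) ->
  branch d r0 q -> trop_map x = q -> rho <= lambdaT l q ->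
  exists2 y, trop_map y = dart_point d r0 & connected_component S x y.
Proof.
move=> + + + + bq; elim: bq x => {d r0 q} [d r0 r rr0|d r0 d' q d't d'r bq IH] x.
  move=> /andP[r0_ge0 r0l] ud dom up xr lr; have /andP[r0r rl] := rr0.
  by apply: (edge_descend _ r0r rl ud up) => //; exact: dom (Branch_here rr0) lr.
move=> r0d ud dom up xq lq; have /andP[r0_ge0 r0l] := r0d.
have l0 := ltW (len_gt0 d'.1).
have [||||y] := IH x _ _ _ _ xq lq.
- by rewrite lexx l0.
- by apply: contra ud; exact: (beyond_next connT treeT).
- by move=> q' bq'; apply: dom; exact: Branch_next bq'.
(* Two branch points beyond [d'] are also beyond [d], so [l u] has not decreased on the way to
   [head d]. *)
- move=> n2; rewrite dart_point0 d't.
  have {}n2 := leq_trans n2 (branch_beyond_next d't d'r).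
  exact: le_trans (up n2) (adm_head_ge r0d ud n2).
rewrite dart_point0 d't -dart_point_len => yh xy.
have Sy : rho <= lambdaT l (dart_point d (len d.1)).
  by have := connected_component_sub xy; rewrite /S /= /lambda yh.
have hb : branch d r0 (dart_point d (len d.1)) by apply: Branch_here; rewrite r0l lexx.
have [z zr0 yz] := edge_descend r0_ge0 r0l (lexx _) ud up (dom _ hb Sy) yh.
by exists z => //; exact: connected_component_trans xy yz.
Qed.

(* Beyond a point with two preimages the branch points come in pairs, so one can
   move on, without decreasing [l u], until the two lifts of the path meet. *)
Lemma lifts_joined u d r0 x y : 0 <= r0 <= len d.1 -> ~~ beyond d u ->
  (2 <= branch_beyond d)%N -> rho <= l u (dart_point d r0) ->
  trop_map x = dart_point d r0 -> trop_map y = dart_point d r0 ->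
  connected_component S x y.
Proof.
elim/(beyond_ind connT treeT): d r0 x y => d IH r0 x y r0d ud n2 lr0 xr0 yr0.
have dl : 0 <= len d.1 <= len d.1 by rewrite lexx ltW ?len_gt0.
have seg t : (r0 <= t <= len d.1) || (len d.1 <= t <= r0) ->
    rho <= lambdaT l (dart_point d t).
  move=> tI; apply: le_trans (lambdaT_ge u _); apply: le_trans lr0 _.
  rewrite (@adm_along u d r0 t) //; last by lra.
  by rewrite lerDl; apply: mulr_ge0; [exact: adm_slope_ge0|lra].
have [x' + xx'] := lift_segment r0d dl xr0 seg.
have [y' + yy'] := lift_segment r0d dl yr0 seg.
rewrite dart_point_len => y'h x'h.
suff x'y' : connected_component S x' y'.
  apply: connected_component_trans xx' _.
  exact: connected_component_trans x'y' (connected_component_sym yy').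
have [v1 x'E v1h] := trop_map_vpointP x'h; have [v2 y'E v2h] := trop_map_vpointP y'h.
have [v12|v12] := eqVneq v1 v2.
  rewrite y'E -v12 -x'E; apply: connected_component_refl.
  by have := connected_component_sub xx'.
have [b0 even_b] := two_lifts_branch (etrans v1h (esym v2h)) v12.
rewrite v1h in b0 even_b.
(* With no branch point at [head d], those beyond [d] must lie beyond a continuing dart; evenness
   then turns one into at least two. *)
have [d' [d't d'r d'n]] : exists d',
    [/\ tail d' = head d, d' != reverse d & (0 < branch_beyond d')%N].
  apply: contrapT => no; move: n2; rewrite branch_beyond_rec b0 big1 // => d'.
  move=> /andP[/eqP d't d'r]; apply/eqP; rewrite -leqn0 leqNgt; apply/negP => d'n.
  by apply: no; exists d'.
have ud' : ~~ beyond d' u by apply: contra ud; exact: (beyond_next connT treeT).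
apply: (IH d' d't d'r 0) => //; rewrite ?dart_point0 ?d't //.
- by rewrite lexx ltW ?len_gt0.
- by have := even_b d' d't; case: (branch_beyond d') d'n => [|[]].
- exact: le_trans lr0 (adm_head_ge r0d ud n2).
Qed.

Lemma special_superlevel_connected x0 : special l x0 -> lambda l x0 = rho ->
  connected S.
Proof.
move=> [_ Dp] lx0; set p := trop_map x0 in Dp.
have lp : lambdaT l p = rho by [].
have active := special_active _ Dp; rewrite lp in active.
have fibre y : trop_map y = p -> connected_component S y x0.
  move=> yp; suff [->|[u [d [dp ud n2 up]]]] : y = x0 \/ exists u d,
      [/\ d \in tangent p, ~~ beyond d u, (2 <= branch_beyond d)%N & rho = l u p].
  - by apply: connected_component_refl; rewrite /S /= lx0.
  - have /andP[p0 /ltW pl] := offset_bounds dp.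
    apply: (@lifts_joined u d (offset p d)); rewrite ?dart_point_offset ?p0 ?pl //.
    by rewrite up.
  (* The six branch points are distributed among the directions at [p]. At a vertex with two lifts
     these numbers are even, so a nonzero one is at least 2; at an interior point there are only two
     directions to share six. *)
  have [[d dp n2]|yx0] : (exists2 d, d \in tangent p & (2 <= branch_beyond d)%N) \/ y = x0.
    have [->|yx0] := eqVneq y x0; [by right|left].
    case E : (val p) => [w|[e t]].
      have pw : p = vpoint w by apply: val_inj.
      have [v1 x0E v1w] := trop_map_vpointP (pw : trop_map x0 = _).
      have [v2 yE v2w] := trop_map_vpointP (etrans yp pw).
      have v12 : v1 != v2 by apply: contra yx0 => /eqP v12; rewrite x0E yE v12.
      have [b0 even_b] := two_lifts_branch (etrans v1w (esym v2w)) v12.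
      rewrite v1w in b0 even_b; have := branch_total w; rewrite b0 add0n => n6.
      have [d dw dn] : exists2 d, tail d = w & (0 < branch_beyond d)%N.
        apply: contrapT => no; move: n6; rewrite big1 // => d /eqP dw.
        by apply/eqP; rewrite -leqn0 leqNgt; apply/negP => dn; apply: no; exists d.
      exists d; first by rewrite pw mem_tangent_vpoint dw.
      by have := even_b d dw; case: (branch_beyond d) dn => [|[]].
    have td b : (e, b) \in tangent p by rewrite /tangent E inE.
    have := branch_beyond_reverse (e, false).
    have [n2 _|n2 n6] := leqP 2 (branch_beyond (e, false)); first by exists (e, false).
    by exists (e, true) => //; rewrite /reverse /= in n6; lia.
  - right; have [u up ud] := active _ rho_gt0 dp.
    by exists u, d.
  - by left.
suff -> : S = connected_component S x0 by exact: component_connected.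
apply/seteqP; split; last exact: connected_component_sub.
move=> x Sx; apply: connected_component_sym.
have [xp|[d dp bd]] := branch_cover connT treeT p (trop_map x); first exact: fibre.
have /andP[p0 /ltW pl] := offset_bounds dp.
have [u up ud] := active _ rho_gt0 dp.
have [|||y yp xy] := @branch_descend u d (offset p d) _ x _ ud _ _ bd erefl Sx.
- by rewrite p0 pl.
(* The function active at [q] does not exceed [l u] at [p], where [l u] is active, so it does not
   exceed it at [q] either. *)
- move=> q bq lq.
  have [v vq] := lambdaT_active (lt_le_trans rho_gt0 lq).
  apply: le_trans lq _; rewrite -vq; apply: (branch_dominated _ ud _ bq).
    by rewrite p0 pl.
  by rewrite dart_point_offset // up -lp; exact: lambdaT_ge.
- by rewrite dart_point_offset // up.
- by apply: connected_component_trans xy _; apply: fibre; rewrite yp dart_point_offset.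
Qed.

End Special.

Theorem lemma3p21 (R : realType) (X : admissible_cover R)
    (l : vert (cov_target X) -> gpoint (cov_target X) -> R)
    (hl : forall u, admissible_function u (l u) /\ normalised (l u))
    (rho1 : R) (hrho1 : exists2 x, special l x & lambda l x = rho1) :
  connected [set x : gpoint (cov_source X) | rho1 <= lambda l x].
Proof.
have [x0 x0_special lx0] := hrho1.
have [rho_le0|rho_gt0] := leP rho1 0.
  have -> : [set x : gpoint (cov_source X) | rho1 <= lambda l x] = setT.
    apply/seteqP; split => // x _; exact: le_trans rho_le0 (lambdaT_ge0 _ _).
  exact: connectedT_graph (@cov_source_connected R X).
exact: (special_superlevel_connected (fun u => (hl u).1) rho_gt0 x0_special).
Qed.
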